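(* Let $E\to M$ be a vector bundle and let $(\mathcal K,(\cdot,\cdot)_E,[\cdot,\cdot]_{\mathcal K},\rho)$ be an $E$-Courant algebroid. Then any Dirac structure $L\subset\mathcal K$ has an induced Lie algebroid structure, namely $(L,[\cdot,\cdot]_{\mathcal K}|_L,(j\circ\rho)|_L)$, and $\rho_L=\rho|_L:L\to\mathfrak DE$ is a representation of this Lie algebroid on $E$.
   Context: Let $E\to M$ be a vector bundle. $\mathfrak DE$ denotes the gauge Lie algebroid (bundle of covariant differential operators): its sections are the $\mathbb R$-linear maps $\mathfrak d:\Gamma(E)\to\Gamma(E)$ for which there is a vector field $j(\mathfrak d)$ on $M$ with $\mathfrak d(fu)=f\,\mathfrak d(u)+j(\mathfrak d)(f)\,u$; its bracket $[\cdot,\cdot]_{\mathfrak D}$ is the commutator and its anchor is $j:\mathfrak DE\to TM$, with kernel $\mathfrak{gl}(E)$. The first jet bundle $\mathfrak JE$ is regarded as the subbundle $\{\nu\in\mathrm{Hom}(\mathfrak DE,E):\nu(\Phi)=\Phi(\nu(\mathrm{Id}_E))\ \forall\Phi\in\mathfrak{gl}(E)\}$, the jet $[u]_m$ corresponding to $\mathfrak d\mapsto \mathfrak d(u)(m)$. The operator $\mathbf d:\Gamma(E)\to\Gamma(\mathfrak JE)$ is $(\mathbf du)(\mathfrak d)=\mathfrak d(u)$. A Leibniz algebra is a module with a bilinear bracket satisfying $[g_1,[g_2,g_3]]=[[g_1,g_2],g_3]+[g_2,[g_1,g_3]]$. An $E$-Courant algebroid is a quadruple $(\mathcal K,(\cdot,\cdot)_E,[\cdot,\cdot]_{\mathcal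 K},\rho)$ where $\mathcal K\to M$ is a vector bundle such that $(\Gamma(\mathcal K),[\cdot,\cdot]_{\mathcal K})$ is a Leibniz algebra (over $\mathbb R$); $(\cdot,\cdot)_E:\mathcal K\otimes\mathcal K\to E$ is a symmetric nondegenerate $E$-valued pairing, inducing an embedding $\mathcal K\hookrightarrow\mathrm{Hom}(\mathcal K,E)$; the anchor $\rho:\mathcal K\to\mathfrak DE$ is a bundle map; with $\rho^\star:\mathrm{Hom}(\mathfrak DE,E)\to\mathrm{Hom}(\mathcal K,E)$, $\rho^\star(\nu)(k)=\nu(\rho(k))$, and for all $X,Y,Z\in\Gamma(\mathcal K)$: (EC-1) $\rho[X,Y]_{\mathcal K}=[\rho(X),\rho(Y)]_{\mathfrak D}$; (EC-2) $[X,X]_{\mathcal K}=\rho^\star\mathbf d(X,X)_E$; (EC-3) $\rho(X)(Y,Z)_E=([X,Y]_{\mathcal K},Z)_E+(Y,[X,Z]_{\mathcal K})_E$; (EC-4) $\rho^\star(\mathfrak JE)\subset\mathcal K$, where an element $\rho^\star(\mu)$ is identified with the element of $\mathcal K$ satisfying $(\rho^\star(\mu),X)_E=\tfrac12\mu(\rho(X))$; (EC-5) $\rho\circ\rho^\star=0$ on $\mathfrak JE$. For a subbundle $L\subset\mathcal K$, $L^\perp=\{e\in\mathcal K:(e,l)_E=0\ \forall l\in L\}$. A Dirac structure is a subbundle $L\subset\mathcal K$ whose space of sections is closed under $[\cdot,\cdot]_{\mathcal K}$ and which satisfies $L=L^\perp$. A representation of a Lie algebroid $L$ on $E$ is a Lie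 algebroid morphism $L\to\mathfrak DE$ over $M$. *)

(* Defs.v *)
From HB Require Import structures.
From mathcomp Require Import all_boot all_order all_algebra.
From mathcomp Require Import boolp classical_sets functions mathcomp_extra filter.
From mathcomp Require Import ring.
From mathcomp Require Import reals interval_inference topology normedtype landau derive.
Set Implicit Arguments. Unset Strict Implicit. Unset Printing Implicit Defensive.
Import Order.TTheory GRing.Theory Num.Theory numFieldNormedType.Exports.
Local Open Scope classical_set_scope.
Local Open Scope ring_scope.

(* C^k and smooth functions on an open subset U of R^n; the values outside U
   are irrelevant. *)
Fixpoint Ck_on (R : realType) (n k : nat) (U : set 'rV[R]_n)
    (f : 'rV[R]_n -> R) : Prop :=
  if k is k'.+1 then
    (forall x, U x -> differentiable f x) /\
    (forall v, Ck_on k' U (fun x => 'D_v f x))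
  else forall x, U x -> {for x, continuous f}.

Definition smooth_on (R : realType) (n : nat) (U : set 'rV[R]_n)
    (f : 'rV[R]_n -> R) : Prop := forall k, Ck_on k U f.

Section Ck.
Context (R : realType) (n : nat) (U : set 'rV[R]_n).
Implicit Types f g : 'rV[R]_n -> R.

Lemma near_eq_differentiable f g x :
  (\forall y \near x, f y = g y) -> differentiable f x -> differentiable g x.
Proof.
move=> fg df; have fgx : f x = g x by exact: nbhs_singleton fg.
have dg : g \o shift x = cst (g x) + 'd f x +o_ 0 id.
  apply/eqaddoP => _/posnumP[e].
  have /eqaddoP/(_ e%:num (gt0 _)) := diff_locally df.
  have fg0 : \forall h \near (0 : 'rV[R]_n), f (h + x) = g (h + x).
    by move: fg; rewrite (near_shift 0 x) subr0.
  move=> H; near=> h.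
  have : `|(f \o shift x - (cst (f x) + 'd f x)) h| <= e%:num * `|id h|.
    by near: h.
  rewrite /= !fctE /= -fgx.
  suff -> : f (h + x) = g (h + x) by [].
  by near: h.
have cdf : continuous ('d f x) by exact: diff_continuous.
have dgE : 'd g x = 'd f x :> (_ -> _) by exact: diff_unique dg.
by apply/diff_locallyP; split; rewrite dgE.
Unshelve. all: by end_near. Qed.

Lemma open_near x (P : 'rV[R]_n -> Prop) :
  open U -> U x -> (forall y, U y -> P y) -> \forall y \near x, P y.
Proof.
by move=> oU Ux UP; have := open_nbhs_nbhs (conj oU Ux); exact: filterS.
Qed.

Lemma eq_Ck_on k f g : open U -> (forall x, U x -> f x = g x) ->
  Ck_on k U f -> Ck_on k U g.
Proof.
move=> oU; elim: k f g => [|k IH] f g fg /=.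
  move=> cf x Ux; have H : \forall y \near x, f y = g y by exact: open_near fg.
  by rewrite /prop_for /continuous_at -(fg _ Ux); apply: cvg_trans (cf x Ux);
    exact: near_eq_cvg H.
move=> [df Df]; split=> [x Ux|v].
  apply: near_eq_differentiable (df x Ux).
  exact: open_near fg.
apply: IH (Df v) => x Ux; apply: near_eq_derive.
exact: open_near fg.
Qed.

Lemma Ck_onS k f : Ck_on k.+1 U f -> Ck_on k U f.
Proof.
elim: k f => [|k IH] f [df Df].
  by move=> x Ux; apply: differentiable_continuous; exact: df.
by split=> // v; apply: IH; exact: Df.
Qed.

Lemma Ck_on_cst k (c : R) : Ck_on k U (cst c).
Proof.
elim: k c => [|k IH] c /=; first by move=> x _; exact: cst_continuous.
split=> [x _|v]; first exact: differentiable_cst.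
have -> : (fun x => 'D_v (cst c : 'rV[R]_n -> R) x) = cst 0.
  by apply/funext => x; rewrite derive_cst.
exact: IH.
Qed.

Lemma Ck_onD k f g : open U -> Ck_on k U f -> Ck_on k U g -> Ck_on k U (f \+ g).
Proof.
move=> oU; elim: k f g => [|k IH] f g /=.
  by move=> cf cg x Ux; exact: (cvgD (cf x Ux) (cg x Ux)).
move=> [df Df] [dg Dg]; split=> [x Ux|v].
  by apply: differentiableD; [exact: df|exact: dg].
apply: eq_Ck_on (IH _ _ (Df v) (Dg v)) => // x Ux /=.
by rewrite deriveD//; apply: diff_derivable; [exact: df|exact: dg].
Qed.

Lemma Ck_onM k f g : open U -> Ck_on k U f -> Ck_on k U g -> Ck_on k U (f \* g).
Proof.
move=> oU; elim: k f g => [|k IH] f g.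
  by move=> cf cg x Ux; exact: (cvgM (cf x Ux) (cg x Ux)).
move=> cf cg; have [df Df] := cf; have [dg Dg] := cg; split=> [x Ux|v].
  by apply: differentiableM; [exact: df|exact: dg].
apply: eq_Ck_on
  (Ck_onD oU (IH _ _ (Ck_onS cf) (Dg v)) (IH _ _ (Ck_onS cg) (Df v))) => // x Ux.
by rewrite /= deriveM//; apply: diff_derivable; [exact: df|exact: dg].
Qed.
End Ck.

Lemma sub_Ck_on (R : realType) (n k : nat) (U V : set 'rV[R]_n) f :
  U `<=` V -> Ck_on k V f -> Ck_on k U f.
Proof.
move=> UV; elim: k f => [|k IH] f /=; first by move=> cf x /UV/cf.
by move=> [df Df]; split=> [x /UV/df //|v]; exact: IH.
Qed.

(* Charted manifolds: every chart [chart i] is a homeomorphism from the open set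
   [chart_dom i] onto the open set [chart_ran i] of R^n, with inverse
   [chart_inv i]; the values outside these sets are irrelevant. *)
Record manifold (R : realType) (n : nat) := Manifold {
  mfd_carrier :> topologicalType;
  manifold_hausdorff : hausdorff_space mfd_carrier;
  manifold_second_countable : @second_countable mfd_carrier;
  chart_index : Type;
  chart_dom : chart_index -> set mfd_carrier;
  chart_ran : chart_index -> set 'rV[R]_n;
  chart : chart_index -> mfd_carrier -> 'rV[R]_n;
  chart_inv : chart_index -> 'rV[R]_n -> mfd_carrier;
  chart_dom_open : forall i, open (chart_dom i);
  chart_ran_open : forall i, open (chart_ran i);
  chart_cover : forall m, exists i, chart_dom i m;
  chart_sub : forall i m, chart_dom i m -> chart_ran i (chart i m);
  chart_inv_sub : forall i y, chart_ran i y -> chart_dom i (chart_inv i y);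
  chartK : forall i m, chart_dom i m -> chart_inv i (chart i m) = m;
  chart_invK : forall i y, chart_ran i y -> chart i (chart_inv i y) = y;
  chart_continuous : forall i m, chart_dom i m -> {for m, continuous (chart i)};
  chart_inv_continuous :
    forall i y, chart_ran i y -> {for y, continuous (chart_inv i)};
  chart_transition : forall i j (k : 'I_n),
    smooth_on (chart_ran i `&` chart_inv i @^-1` chart_dom j)
              (fun y => chart j (chart_inv i y) 0 k) }.
Arguments chart_index {R n}  _.
Arguments chart_dom {R n}  _ i.
Arguments chart_ran {R n}  _ i.
Arguments chart {R n}  _ i m.
Arguments chart_inv {R n}  _ i y.

Section SmoothFunctions.
Context (R : realType) (n : nat) (M : manifold R n).

Definition smooth_fun_on (W : set M) (f : M -> R) : Prop :=
  forall i, smooth_on (chart_ran M i `&` chart_inv M i @^-1` W)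
                      (fun y => f (chart_inv M i y)).

Lemma open_chart_preimage (i : chart_index M) (W : set M) : open W ->
  open (chart_ran M i `&` chart_inv M i @^-1` W).
Proof.
move=> oW; rewrite openE => y [ry Wy].
apply: filterI; first by apply: open_nbhs_nbhs; split=> //; exact: chart_ran_open.
exact: (chart_inv_continuous ry (open_nbhs_nbhs (conj oW Wy))).
Qed.

Lemma smooth_fun_on_cst W (c : R) : smooth_fun_on W (fun=> c).
Proof. by move=> i k; exact: Ck_on_cst. Qed.

Lemma smooth_fun_onD W f g : open W ->
  smooth_fun_on W f -> smooth_fun_on W g -> smooth_fun_on W (fun m => f m + g m).
Proof.
by move=> oW sf sg i k; exact: Ck_onD (open_chart_preimage oW) (sf i k) (sg i k).
Qed.

Lemma smooth_fun_onM W f g : open W ->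
  smooth_fun_on W f -> smooth_fun_on W g -> smooth_fun_on W (fun m => f m * g m).
Proof.
by move=> oW sf sg i k; exact: Ck_onM (open_chart_preimage oW) (sf i k) (sg i k).
Qed.

Lemma sub_smooth_fun_on V W f : V `<=` W -> smooth_fun_on W f -> smooth_fun_on V f.
Proof. by move=> VW sf i k; apply: sub_Ck_on (sf i k) => y [ry /VW]. Qed.

Definition smooth_fun : {pred M -> R} := fun f => `[< smooth_fun_on setT f >].

Lemma smooth_funP f : reflect (smooth_fun_on setT f) (f \in smooth_fun).
Proof. exact: asboolP. Qed.

Lemma smooth_fun_subring : subring_closed smooth_fun.
Proof.
have smooth_funD := smooth_fun_onD openT; have smooth_funM := smooth_fun_onM openT.
split=> [|f g /smooth_funP sf /smooth_funP sg|f g /smooth_funP sf /smooth_funP sg].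
- by apply/smooth_funP; exact: smooth_fun_on_cst.
- have := smooth_funD _ _ sf (smooth_funM _ _ (@smooth_fun_on_cst _ (-1)) sg).
  move=> sfg; apply/smooth_funP; congr smooth_fun_on: sfg.
  by apply/funext => m; rewrite mulN1r.
- by apply/smooth_funP; exact: smooth_funM.
Qed.

Lemma smooth_fun_scale (a : R) f : f \in smooth_fun -> a *: f \in smooth_fun.
Proof.
move=> /smooth_funP sf; apply/smooth_funP.
exact: (smooth_fun_onM openT (@smooth_fun_on_cst _ a) sf).
Qed.

HB.instance Definition _ :=
  GRing.isSubringClosed.Build (M -> R) smooth_fun smooth_fun_subring.
HB.instance Definition _ :=
  GRing.isScaleClosed.Build R (M -> R) smooth_fun smooth_fun_scale.

Record Cinf := MkCinf { Cinf_val :> M -> R; _ : Cinf_val \in smooth_fun }.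
HB.instance Definition _ := [isSub for Cinf_val].
HB.instance Definition _ := [Choice of Cinf by <:].
HB.instance Definition _ := 
  GRing.SubChoice_isSubComPzRing.Build _ _ Cinf (GRing.subringClosedP _).
HB.instance Definition _ := [SubZmodule_isSubLmodule of Cinf by <:].

End SmoothFunctions.

(* Fibres over the points of M together with the notion of smooth section; the
   fibres need not form a locally trivial family. *)
Record smooth_family (R : realType) (n : nat) (M : manifold R n) :=
  SmoothFamily {
    fib :> M -> lmodType R;
    smooth_section : (forall m, fib m) -> Prop;
    smooth_section0 : smooth_section (fun m => 0);
    smooth_sectionD : forall s t, smooth_section s -> smooth_section t ->
      smooth_section (fun m => s m + t m);
    smooth_sectionZ : forall (f : Cinf M) s, smooth_section s ->
      smooth_section (fun m => f m *: s m) }.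

Definition raw_section (R : realType) (n : nat) (M : manifold R n)
  (F : smooth_family M) := forall m, F m.

Section RawSections.
Context (R : realType) (n : nat) (M : manifold R n) (F : smooth_family M).
Implicit Types s t u : raw_section F.

HB.instance Definition _ := Choice.copy (raw_section F) (forall m, F m).

Definition raw_zero : raw_section F := fun m => 0.
Definition raw_opp s : raw_section F := fun m => - s m.
Definition raw_add s t : raw_section F := fun m => s m + t m.
Definition raw_scale (a : R) s : raw_section F := fun m => a *: s m.

Lemma raw_addA : associative raw_add.
Proof. by move=> s t u; apply: functional_extensionality_dep => m; exact: addrA. Qed.
Lemma raw_addC : commutative raw_add.
Proof. by move=> s t; apply: functional_extensionality_dep => m; exact: addrC. Qed.
Lemma raw_add0 : left_id raw_zero raw_add.
Proof. by move=> s; apply: functional_extensionality_dep => m; exact: add0r. Qed.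
Lemma raw_addN : left_inverse raw_zero raw_opp raw_add.
Proof. by move=> s; apply: functional_extensionality_dep => m; exact: addNr. Qed.

HB.instance Definition _ := GRing.isZmodule.Build (raw_section F)
  raw_addA raw_addC raw_add0 raw_addN.

Lemma raw_scaleA a b s : raw_scale a (raw_scale b s) = raw_scale (a * b) s.
Proof. by apply: functional_extensionality_dep => m; exact: scalerA. Qed.
Lemma raw_scale1 : left_id 1 raw_scale.
Proof. by move=> s; apply: functional_extensionality_dep => m; exact: scale1r. Qed.
Lemma raw_scaleDr : right_distributive raw_scale +%R.
Proof. by move=> a s t; apply: functional_extensionality_dep => m; exact: scalerDr. Qed.
Lemma raw_scaleDl s : {morph raw_scale^~ s : a b / a + b}.
Proof. by move=> a b; apply: functional_extensionality_dep => m; exact: scalerDl. Qed.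

HB.instance Definition _ := GRing.Zmodule_isLmodule.Build R (raw_section F)
  raw_scaleA raw_scale1 raw_scaleDr raw_scaleDl.

Definition is_smooth : {pred raw_section F} := fun s => `[< smooth_section s >].

Lemma is_smoothP s : reflect (smooth_section s) (s \in is_smooth).
Proof. exact: asboolP. Qed.

Lemma Cinf_cst_subproof (a : R) : (fun=> a) \in @smooth_fun R n M.
Proof. by apply/smooth_funP; exact: smooth_fun_on_cst. Qed.

Definition Cinf_cst (a : R) : Cinf M := MkCinf (Cinf_cst_subproof a).

Lemma is_smooth_submod : GRing.submod_closed is_smooth.
Proof.
split=> [|a s t /is_smoothP ss /is_smoothP st]; apply/is_smoothP.
  exact: smooth_section0.
exact: smooth_sectionD (smooth_sectionZ (Cinf_cst a) ss) st.
Qed.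

HB.instance Definition _ :=
  GRing.isSubmodClosed.Build R (raw_section F) is_smooth is_smooth_submod.

Record section := MkSection { sec_val : raw_section F; _ : sec_val \in is_smooth }.
HB.instance Definition _ := [isSub for sec_val].
HB.instance Definition _ := [Choice of section by <:].
HB.instance Definition _ := [SubChoice_isSubZmodule of section by <:].
HB.instance Definition _ := [SubZmodule_isSubLmodule of section by <:].

Definition sec_fun (s : section) : forall m, F m := sec_val s.
Coercion sec_fun : section >-> Funclass.

Lemma section_smooth (s : section) : smooth_section s.
Proof. by case: s => s /= /is_smoothP. Qed.

Definition mk_section (s : forall m, F m) (ss : smooth_section s) : section :=
  MkSection (introT (is_smoothP s) ss).

Lemma section_ext (s t : section) : (forall m, s m = t m) -> s = t.
Proof. by move=> st; apply: val_inj; apply: functional_extensionality_dep. Qed.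

Definition fmul (f : Cinf M) (s : section) : section :=
  mk_section (smooth_sectionZ f (section_smooth s)).

End RawSections.
Arguments section {R n M} F.

(* Bundle maps over the identity of M: fibrewise linear and sending smooth
   sections to smooth sections. *)
Record bundle_map (R : realType) (n : nat) (M : manifold R n)
    (F G : smooth_family M) := BundleMap {
  bm_fib :> forall m, {linear F m -> G m};
  bm_smooth : forall s : section F, smooth_section (fun m => bm_fib m (s m)) }.

Definition bm_sec (R : realType) (n : nat) (M : manifold R n)
    (F G : smooth_family M) (phi : bundle_map F G) (s : section F) : section G :=
  mk_section (bm_smooth phi s).

Definition bm_comp (R : realType) (n : nat) (M : manifold R n)
    (F G H : smooth_family M) (psi : bundle_map G H) (phi : bundle_map F G) :
    bundle_map F H :=
  @BundleMap _ _ _ F H (fun m => (psi m \o phi m)%FUN : {linear F m -> H m})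
    (fun s => bm_smooth psi (bm_sec phi s)).

(* A vector bundle structure on a family of finite-dimensional vector spaces:
   fibrewise linear trivialisations over an open cover, with smooth transition
   matrices. *)
Record bundle_atlas (R : realType) (n : nat) (M : manifold R n)
    (V : M -> vectType R) := BundleAtlas {
  triv_index : Type;
  triv_dom : triv_index -> set M;
  triv_rank : triv_index -> nat;
  triv : forall a m, 'Hom(V m, 'rV[R]_(triv_rank a));
  triv_dom_open : forall a, open (triv_dom a);
  triv_cover : forall m, exists a, triv_dom a m;
  triv_inj : forall a m, triv_dom a m -> lker (triv a m) = 0%VS;
  triv_surj : forall a m, triv_dom a m -> limg (triv a m) = fullv;
  triv_transition : forall a b v j,
    smooth_fun_on (triv_dom a `&` triv_dom b)
                  (fun m => triv b m ((triv a m)^-1%VF v) 0 j) }.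
Arguments triv_dom {R n M V}  _ a.
Arguments triv_rank {R n M V}  _ a.
Arguments triv {R n M V}  _ a m.
Arguments triv_dom_open {R n M V}  _ a.

Record vector_bundle (R : realType) (n : nat) (M : manifold R n) :=
  VectorBundle {
    vb_fib : M -> vectType R;
    vb_atlas : bundle_atlas vb_fib }.

Section VectorBundleSections.
Context (R : realType) (n : nat) (M : manifold R n) (E : vector_bundle M).
Let A := vb_atlas E.

Definition vb_smooth (s : forall m, vb_fib E m) : Prop :=
  forall a j, smooth_fun_on (triv_dom A a) (fun m => triv A a m (s m) 0 j).

Lemma vb_smooth0 : vb_smooth (fun m => 0).
Proof.
move=> a j; have := @smooth_fun_on_cst R n M (triv_dom A a) 0.
by congr smooth_fun_on; apply/funext => m; rewrite linear0 mxE.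
Qed.

Lemma vb_smoothD s t : vb_smooth s -> vb_smooth t -> vb_smooth (fun m => s m + t m).
Proof.
move=> ss st a j; have := smooth_fun_onD (triv_dom_open A a) (ss a j) (st a j).
by congr smooth_fun_on; apply/funext => m; rewrite linearD mxE.
Qed.

Lemma vb_smoothZ (f : Cinf M) s : vb_smooth s -> vb_smooth (fun m => f m *: s m).
Proof.
move=> ss a j; have /smooth_funP sf := valP f.
have sfa := sub_smooth_fun_on (@subsetT _ (triv_dom A a)) sf.
have := smooth_fun_onM (triv_dom_open A a) sfa (ss a j).
by congr smooth_fun_on; apply/funext => m; rewrite linearZ mxE.
Qed.

Definition vb_family : smooth_family M :=
  @SmoothFamily _ _ M (fun m => vb_fib E m : lmodType R) vb_smooth
    vb_smooth0 vb_smoothD vb_smoothZ.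

End VectorBundleSections.
Coercion vb_family : vector_bundle >-> smooth_family.

Section Tangent.
Context (R : realType) (n : nat) (M : manifold R n).

Definition is_derivation_at (m : M) (v : Cinf M -> R) : Prop :=
  scalar v /\ forall f g : Cinf M, v (f * g) = f m * v g + g m * v f.

Definition derivation_at (m : M) : {pred Cinf M -> R} :=
  fun v => `[< is_derivation_at m v >].

Lemma derivation_atP m v : reflect (is_derivation_at m v) (v \in derivation_at m).
Proof. exact: asboolP. Qed.

Lemma derivation_at_submod m : GRing.submod_closed (derivation_at m).
Proof.
split=> [|a v w /derivation_atP[vl vM] /derivation_atP[wl wM]];
  apply/derivation_atP.
  split=> [a f g|f g]; first by change (0 = a * 0 + 0 :> R); ring.
  by change (0 = f m * 0 + g m * 0 :> R); ring.
split=> [b f g|f g].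
  change (a * v (b *: f + g) + w (b *: f + g) =
          b * (a * v f + w f) + (a * v g + w g)).
  by rewrite vl wl; ring.
change (a * v (f * g) + w (f * g) =
        f m * (a * v g + w g) + g m * (a * v f + w f)).
by rewrite vM wM; ring.
Qed.

HB.instance Definition _ m := GRing.isSubmodClosed.Build R (Cinf M -> R)
  (derivation_at m) (derivation_at_submod m).

Record tangent (m : M) := MkTangent {
  tangent_val :> Cinf M -> R; _ : tangent_val \in derivation_at m }.
HB.instance Definition _ m := [isSub for @tangent_val m].
HB.instance Definition _ m := [Choice of tangent m by <:].
HB.instance Definition _ m := [SubChoice_isSubZmodule of tangent m by <:].
HB.instance Definition _ m := [SubZmodule_isSubLmodule of tangent m by <:].

Definition vf_smooth (X : forall m, tangent m) : Prop :=
  forall f : Cinf M, smooth_fun_on setT (fun m => X m f).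

End Tangent.

Section TangentBundle.
Context (R : realType) (n : nat) (M : manifold R n).

Lemma tangent_linear (m : M) (v : tangent m) : scalar v.
Proof. by case: v => v /= /derivation_atP[]. Qed.

Lemma tangentM (m : M) (v : tangent m) (f g : Cinf M) :
  v (f * g) = f m * v g + g m * v f.
Proof. by case: v => v /= /derivation_atP[]. Qed.

Lemma tangent_linE (m : M) (a : R) (v w : tangent m) (f : Cinf M) :
  (a *: v + w) f = a * v f + w f.
Proof. by []. Qed.

Lemma vf_smooth0 : vf_smooth (fun m : M => 0).
Proof. by move=> f; exact: smooth_fun_on_cst. Qed.

Lemma vf_smoothD (X Y : forall m : M, tangent m) :
  vf_smooth X -> vf_smooth Y -> vf_smooth (fun m => X m + Y m).
Proof. by move=> sX sY f; exact: smooth_fun_onD openT (sX f) (sY f). Qed.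

Lemma vf_smoothZ (f : Cinf M) (X : forall m : M, tangent m) :
  vf_smooth X -> vf_smooth (fun m => f m *: X m).
Proof.
move=> sX g; have /smooth_funP sf := valP f.
exact: smooth_fun_onM openT sf (sX g).
Qed.

Definition TM : smooth_family M :=
  @SmoothFamily _ _ M (fun m => tangent m : lmodType R) (@vf_smooth _ _ M)
    vf_smooth0 vf_smoothD vf_smoothZ.

Lemma vf_app_subproof (X : section TM) (f : Cinf M) :
  (fun m => (X m : tangent m) f) \in @smooth_fun R n M.
Proof. by apply/smooth_funP; exact: (section_smooth X). Qed.

(* The function X(f). *)
Definition vf_app (X : section TM) (f : Cinf M) : Cinf M :=
  MkCinf (vf_app_subproof X f).

Lemma vf_app_linear (X : section TM) : linear (vf_app X).
Proof.
by move=> a f g; apply: val_inj; apply/funext => m; exact: tangent_linear.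
Qed.

Lemma vf_appM (X : section TM) f g : vf_app X (f * g) = f * vf_app X g + g * vf_app X f.
Proof. by apply: val_inj; apply/funext => m; exact: tangentM. Qed.

Lemma vf_bracket_subproof (X Y : section TM) (m : M) :
  (fun f => (X m : tangent m) (vf_app Y f) - (Y m : tangent m) (vf_app X f))
    \in derivation_at m.
Proof.
apply/derivation_atP; split=> [a f g|f g].
  by rewrite !vf_app_linear !tangent_linear /=; ring.
rewrite !vf_appM; have tD (v : tangent m) f1 g1 : v (f1 + g1) = v f1 + v g1.
  by have := tangent_linear v 1 f1 g1; rewrite !scale1r /= mul1r.
by rewrite !tD !tangentM /=; ring.
Qed.

Definition vf_bracket_fun (X Y : section TM) (m : M) : tangent m :=
  MkTangent (vf_bracket_subproof X Y m).

Lemma vf_bracket_smooth (X Y : section TM) : @smooth_section _ _ _ TM (vf_bracket_fun X Y).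
Proof.
move=> f; have /smooth_funP := valP (vf_app X (vf_app Y f) - vf_app Y (vf_app X f)).
by [].
Qed.

Definition vf_bracket (X Y : section TM) : section TM :=
  mk_section (vf_bracket_smooth X Y).

End TangentBundle.
Arguments TM {R n} M.

Section Gauge.
Context (R : realType) (n : nat) (M : manifold R n) (E : vector_bundle M).

Definition is_gauge_at (m : M) (d : (section E -> E m) * tangent m) : Prop :=
  linear d.1 /\
  forall (f : Cinf M) (u : section E),
    d.1 (fmul f u) = f m *: d.1 u + d.2 f *: u m.

Definition gauge_at (m : M) : {pred (section E -> E m) * tangent m} :=
  fun d => `[< is_gauge_at d >].

Arguments gauge_at m : clear implicits.

Lemma gauge_atP m (d : (section E -> E m) * tangent m) :
  reflect (is_gauge_at d) (d \in gauge_at m).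
Proof. exact: asboolP. Qed.

Lemma gauge_at_submod m : GRing.submod_closed (gauge_at m).
Proof.
split=> [|a d e /gauge_atP[dl dM] /gauge_atP[el eM]]; apply/gauge_atP; split.
- by move=> a u v; change (0 = a *: 0 + 0 :> E m); rewrite scaler0 addr0.
- move=> f u; change (0 = f m *: 0 + 0 *: u m :> E m).
  by rewrite scaler0 scale0r addr0.
- move=> b u v.
  have dE x : (a *: d + e).1 x = a *: d.1 x + e.1 x by [].
  by rewrite !dE dl el !scalerDr !scalerA (mulrC a) addrACA.
- move=> f u.
  have dE x : (a *: d + e).1 x = a *: d.1 x + e.1 x by [].
  have -> : (a *: d + e).2 = a *: d.2 + e.2 by [].
  by rewrite tangent_linE !dE dM eM !scalerDr scalerDl !scalerA (mulrC a) addrACA.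
Qed.

HB.instance Definition _ m := GRing.isSubmodClosed.Build R
  ((section E -> E m) * tangent m)%type (gauge_at m) (gauge_at_submod m).

(* The fibre of the gauge algebroid at m: derivations at m of the sections of E,
   paired with their symbol.  When E has positive rank the symbol is determined
   by the derivation; when E = 0 the pairs give TM. *)
Record gauge_fib (m : M) := MkGauge {
  gauge_val : (section E -> E m) * tangent m; _ : gauge_val \in gauge_at m }.
HB.instance Definition _ m := [isSub for @gauge_val m].
HB.instance Definition _ m := [Choice of gauge_fib m by <:].
HB.instance Definition _ m := [SubChoice_isSubZmodule of gauge_fib m by <:].
HB.instance Definition _ m := [SubZmodule_isSubLmodule of gauge_fib m by <:].

Definition gauge_op (m : M) (d : gauge_fib m) : section E -> E m := (gauge_val d).1.
Definition gauge_symbol (m : M) (d : gauge_fib m) : tangent m := (gauge_val d).2.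

Lemma gauge_op_linear m (d : gauge_fib m) : linear (gauge_op d).
Proof. by have /gauge_atP[] := valP d. Qed.

Lemma gauge_opM m (d : gauge_fib m) (f : Cinf M) (u : section E) :
  gauge_op d (fmul f u) = f m *: gauge_op d u + gauge_symbol d f *: u m.
Proof. by have /gauge_atP[_ dM] := valP d; exact: dM. Qed.

Lemma gauge_ext m (d e : gauge_fib m) :
  (forall u, gauge_op d u = gauge_op e u) ->
  (forall f, gauge_symbol d f = gauge_symbol e f) -> d = e.
Proof.
case: d e => [[d v] dP] [[e w] eP] /= de vw; apply: val_inj => /=.
by congr pair; [exact/funext|apply: val_inj; exact/funext].
Qed.

Lemma gauge_symbol_linear m : linear (@gauge_symbol m).
Proof. by []. Qed.
HB.instance Definition _ m := GRing.isLinear.Build R (gauge_fib m) (tangent m) _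
  (@gauge_symbol m) (@gauge_symbol_linear m).

Lemma gauge_op_linE m a (d e : gauge_fib m) u :
  gauge_op (a *: d + e) u = a *: gauge_op d u + gauge_op e u.
Proof. by []. Qed.

Definition gauge_smooth (d : forall m, gauge_fib m) : Prop :=
  (forall u : section E, @smooth_section _ _ _ E (fun m => gauge_op (d m) u)) /\
  @smooth_section _ _ _ (TM M) (fun m => gauge_symbol (d m)).

Lemma gauge_smooth_lin (f : Cinf M) d e : gauge_smooth d -> gauge_smooth e ->
  gauge_smooth (fun m => f m *: d m + e m).
Proof.
move=> [sd sjd] [se sje]; split=> [u|].
  exact: smooth_sectionD (smooth_sectionZ f (sd u)) (se u).
have := smooth_sectionD (smooth_sectionZ f sjd) sje.
by congr smooth_section; apply: functional_extensionality_dep => m.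
Qed.

Lemma gauge_smooth0 : gauge_smooth (fun m => 0).
Proof. by split=> [u|]; exact: smooth_section0. Qed.

Lemma gauge_smoothD d e :
  gauge_smooth d -> gauge_smooth e -> gauge_smooth (fun m => d m + e m).
Proof.
move=> sd se; have := gauge_smooth_lin 1 sd se.
by congr gauge_smooth; apply: functional_extensionality_dep => m; rewrite scale1r.
Qed.

Lemma gauge_smoothZ (f : Cinf M) d : gauge_smooth d -> gauge_smooth (fun m => f m *: d m).
Proof.
move=> sd; have := gauge_smooth_lin f sd gauge_smooth0.
by congr gauge_smooth; apply: functional_extensionality_dep => m; rewrite addr0.
Qed.

Definition gauge : smooth_family M :=
  @SmoothFamily _ _ M (fun m => gauge_fib m : lmodType R) gauge_smooth
    gauge_smooth0 gauge_smoothD gauge_smoothZ.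

(* The operator on the sections of E given by a section of the gauge algebroid. *)
Definition gauge_app (d : section gauge) (u : section E) : section E :=
  mk_section ((section_smooth d).1 u).

(* The anchor j. *)
Definition gauge_anchor : bundle_map gauge (TM M) :=
  @BundleMap _ _ _ gauge (TM M)
    (fun m => @gauge_symbol m : {linear gauge_fib m -> tangent m})
    (fun d => (section_smooth d).2).

Lemma gauge_app_linear (d : section gauge) : linear (gauge_app d).
Proof. by move=> a u v; apply: section_ext => m; exact: gauge_op_linear. Qed.

Lemma gauge_appM (d : section gauge) f u :
  gauge_app d (fmul f u) =
  fmul f (gauge_app d u) + fmul (vf_app (bm_sec gauge_anchor d) f) u.
Proof. by apply: section_ext => m; exact: gauge_opM. Qed.

Lemma addr_cancel_aux (V : zmodType) (a b c d g h : V) :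
  a + b + (c + d) - (g + c + (b + h)) = a - g + (d - h).
Proof.
rewrite !opprD [LHS](AC ((2*2)*(2*2)) ((1*5)*(4*8)*(2*7)*(3*6))) /=.
by rewrite !subrr !addr0.
Qed.

Lemma gauge_bracket_subproof (d e : section gauge) (m : M) :
  ((fun u => gauge_op (d m) (gauge_app e u) - gauge_op (e m) (gauge_app d u)),
   vf_bracket (bm_sec gauge_anchor d) (bm_sec gauge_anchor e) m : tangent m)
    \in gauge_at m.
Proof.
apply/gauge_atP; split=> [a u v|f u] /=.
  by rewrite !gauge_app_linear !gauge_op_linear scalerBr opprD addrACA.
have opD (c : gauge_fib m) u1 u2 : gauge_op c (u1 + u2) = gauge_op c u1 + gauge_op c u2.
  by have := gauge_op_linear c 1 u1 u2; rewrite !scale1r.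
rewrite !gauge_appM !opD !gauge_opM.
set x := gauge_op (d m) _; set y := gauge_op (e m) (gauge_app d u).
set p := gauge_op (e m) u; set q := gauge_op (d m) u.
set D := gauge_symbol (d m); set F := gauge_symbol (e m).
change (f m *: x + D f *: p + (F f *: q +
   D (vf_app (bm_sec gauge_anchor e) f) *: u m) -
  (f m *: y + F f *: q + (D f *: p + F (vf_app (bm_sec gauge_anchor d) f) *: u m)) =
  f m *: (x - y) + (D (vf_app (bm_sec gauge_anchor e) f) -
    F (vf_app (bm_sec gauge_anchor d) f)) *: u m).
rewrite scalerBr scalerBl; exact: addr_cancel_aux.
Qed.

Definition gauge_bracket_fun (d e : section gauge) (m : M) : gauge_fib m :=
  MkGauge (gauge_bracket_subproof d e m).

Lemma gauge_bracket_smooth (d e : section gauge) : gauge_smooth (gauge_bracket_fun d e).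
Proof.
split=> [u|].
  exact: (section_smooth (gauge_app d (gauge_app e u) - gauge_app e (gauge_app d u))).
exact: (section_smooth (vf_bracket (bm_sec gauge_anchor d) (bm_sec gauge_anchor e))).
Qed.

Definition gauge_bracket (d e : section gauge) : section gauge :=
  @mk_section _ _ _ gauge _ (gauge_bracket_smooth d e).

Lemma gauge_bracketE d e u :
  gauge_app (gauge_bracket d e) u =
  gauge_app d (gauge_app e u) - gauge_app e (gauge_app d u).
Proof. by apply: section_ext. Qed.

Lemma gl_subproof (m : M) (Phi : 'End(vb_fib E m)) :
  ((fun u : section E => Phi (u m) : E m), 0 : tangent m) \in gauge_at m.
Proof.
apply/gauge_atP; split=> [a u v|f u] /=.
  by change (Phi (a *: u m + v m) = a *: Phi (u m) + Phi (v m)); rewrite linearP.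
change (Phi (f m *: u m) = f m *: Phi (u m) + 0 *: u m).
by rewrite linearZ scale0r addr0.
Qed.

(* The inclusion of gl(E) into the gauge algebroid, as the kernel of j. *)
Definition gl_incl (m : M) (Phi : 'End(vb_fib E m)) : gauge_fib m :=
  MkGauge (gl_subproof Phi).

(* The fibre of the jet bundle at m, inside Hom(DE, E)_m. *)
Definition is_jet (m : M) (nu : {linear gauge_fib m -> vb_fib E m}) : Prop :=
  forall Phi : 'End(vb_fib E m), nu (gl_incl Phi) = Phi (nu (gl_incl \1%VF)).

Definition jet_fun (u : section E) (m : M) (d : gauge_fib m) : vb_fib E m :=
  gauge_op d u.

Lemma jet_fun_linear u m : linear (@jet_fun u m).
Proof. by []. Qed.
HB.instance Definition _ u m := GRing.isLinear.Build R (gauge_fib m) (vb_fib E m) _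
  (@jet_fun u m) (@jet_fun_linear u m).

(* The operator d : Gamma(E) -> Gamma(JE). *)
Definition jet (u : section E) (m : M) : {linear gauge_fib m -> vb_fib E m} :=
  @jet_fun u m.

Lemma jetP u m : is_jet (jet u m).
Proof. by move=> Phi; rewrite /= /jet_fun /gauge_op /= id_lfunE. Qed.

End Gauge.

Section Algebroids.
Context (R : realType) (n : nat) (M : manifold R n).

Definition is_leibniz_algebra (V : lmodType R) (br : V -> V -> V) : Prop :=
  [/\ forall x, linear (br x), forall y, linear (br^~ y) &
      forall x y z, br x (br y z) = br (br x y) z + br y (br x z)].

Definition is_lie_algebra (V : lmodType R) (br : V -> V -> V) : Prop :=
  [/\ forall x, linear (br x), forall y, linear (br^~ y),
      forall x, br x x = 0 &
      forall x y z, br x (br y z) + br y (br z x) + br z (br x y) = 0].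

Definition lie_algebroid_axioms (F : smooth_family M)
    (br : section F -> section F -> section F) (a : bundle_map F (TM M)) : Prop :=
  [/\ is_lie_algebra br,
      forall (X Y : section F) (f : Cinf M),
        br X (fmul f Y) = fmul f (br X Y) + fmul (vf_app (bm_sec a X) f) Y &
      forall X Y : section F,
        bm_sec a (br X Y) = vf_bracket (bm_sec a X) (bm_sec a Y)].

Definition is_lie_algebroid (A : vector_bundle M)
    (br : section A -> section A -> section A) (a : bundle_map A (TM M)) : Prop :=
  lie_algebroid_axioms br a.

Definition is_lie_algebroid_morphism (F G : smooth_family M)
    (brF : section F -> section F -> section F) (aF : bundle_map F (TM M))
    (brG : section G -> section G -> section G) (aG : bundle_map G (TM M))
    (phi : bundle_map F G) : Prop :=
  (forall m (x : F m), aG m (phi m x) = aF m x) /\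
  (forall X Y : section F,
     bm_sec phi (brF X Y) = brG (bm_sec phi X) (bm_sec phi Y)).

Definition is_representation (A : vector_bundle M)
    (br : section A -> section A -> section A) (a : bundle_map A (TM M))
    (E : vector_bundle M) (phi : bundle_map A (gauge E)) : Prop :=
  is_lie_algebroid_morphism br a (@gauge_bracket _ _ _ E) (gauge_anchor E) phi.

End Algebroids.

Section GaugeLieAlgebroid.
Context (R : realType) (n : nat) (M : manifold R n) (E : vector_bundle M).
Implicit Types (d e : section (gauge E)) (X Y : section (TM M)).

HB.instance Definition _ X := GRing.isLinear.Build R (Cinf M) (Cinf M) _
  (vf_app X) (@vf_app_linear _ _ _ X).
HB.instance Definition _ d := GRing.isLinear.Build R (section E) (section E) _
  (gauge_app d) (@gauge_app_linear _ _ _ _ d).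

Let j d := bm_sec (gauge_anchor E) d.

Lemma gauge_section_ext d e : (forall u, gauge_app d u = gauge_app e u) ->
  (forall f, vf_app (j d) f = vf_app (j e) f) -> d = e.
Proof.
move=> de jde; apply: section_ext => m; apply: gauge_ext => [u|f].
  by have := congr1 (fun s => sec_fun s m) (de u).
by have := congr1 (fun g => Cinf_val g m) (jde f).
Qed.

Lemma gauge_app_sum a d e u :
  gauge_app (a *: d + e) u = a *: gauge_app d u + gauge_app e u.
Proof. by apply: section_ext. Qed.

Lemma vf_app_sum a X Y f : vf_app (a *: X + Y) f = a *: vf_app X f + vf_app Y f.
Proof. by apply: val_inj; apply/funext. Qed.

Lemma gauge_anchor_sum a d e : j (a *: d + e) = a *: j d + j e.
Proof. by apply: section_ext. Qed.

Lemma gauge_app_add d e u : gauge_app (d + e) u = gauge_app d u + gauge_app e u.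
Proof. by apply: section_ext. Qed.

Lemma vf_app_add X Y f : vf_app (X + Y) f = vf_app X f + vf_app Y f.
Proof. by apply: val_inj; apply/funext. Qed.

Lemma gauge_anchor_add d e : j (d + e) = j d + j e.
Proof. by apply: section_ext. Qed.

Lemma vf_bracketE X Y f :
  vf_app (vf_bracket X Y) f = vf_app X (vf_app Y f) - vf_app Y (vf_app X f).
Proof. by apply: val_inj; apply/funext. Qed.

Lemma gauge_anchor_bracket d e : j (gauge_bracket d e) = vf_bracket (j d) (j e).
Proof. by apply: section_ext. Qed.

Lemma commutator_linear (U : lmodType R) (a : R) (x y z t : U) :
  a *: x + y - (a *: z + t) = a *: (x - z) + (y - t).
Proof. by rewrite opprD addrACA scalerBr. Qed.

Lemma jacobi_aux (U : zmodType) (a b p q r t : U) :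
  a - b + (- p - - q) + (p - r + (- t - - b)) + (t - q + (- a - - r)) = 0.
Proof.
rewrite !opprK [LHS](AC ((2*2)*(2*2)*(2*2))
  ((1*11)*(8*2)*(4*10)*(5*3)*(12*6)*(9*7))) /=.
by rewrite !subrr !addr0.
Qed.

Lemma fmulB (f : Cinf M) (u v : section E) : fmul f (u - v) = fmul f u - fmul f v.
Proof. by apply: section_ext => m; exact: scalerBr. Qed.

Lemma gauge_app_fmul f d u : gauge_app (fmul f d) u = fmul f (gauge_app d u).
Proof. by apply: section_ext. Qed.

Lemma vf_app_fmul f X g : vf_app (fmul f X) g = f * vf_app X g.
Proof. by apply: val_inj; apply/funext. Qed.

Lemma gauge_anchor_fmul f d : j (fmul f d) = fmul f (j d).
Proof. by apply: section_ext. Qed.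

Lemma gauge_lie_algebroid :
  lie_algebroid_axioms (@gauge_bracket _ _ _ E) (gauge_anchor E).
Proof.
split; first split.
- move=> d a e e'; apply: gauge_section_ext => [u|f].
    by rewrite gauge_app_sum !gauge_bracketE !gauge_app_sum linearP commutator_linear.
  rewrite gauge_anchor_sum vf_app_sum !gauge_anchor_bracket gauge_anchor_sum.
  by rewrite !vf_bracketE !vf_app_sum linearP commutator_linear.
- move=> d a e e'; apply: gauge_section_ext => [u|f].
    by rewrite gauge_app_sum !gauge_bracketE !gauge_app_sum linearP commutator_linear.
  rewrite gauge_anchor_sum vf_app_sum !gauge_anchor_bracket gauge_anchor_sum.
  by rewrite !vf_bracketE !vf_app_sum linearP commutator_linear.
- move=> d; apply: gauge_section_ext => [u|f].
    by rewrite gauge_bracketE subrr; apply: section_ext.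
  by rewrite gauge_anchor_bracket vf_bracketE subrr; apply: val_inj; apply/funext.
- move=> d e c; apply: gauge_section_ext => [u|f].
    rewrite !gauge_app_add !gauge_bracketE !linearB /= jacobi_aux.
    by apply: section_ext.
  rewrite !gauge_anchor_add !vf_app_add !gauge_anchor_bracket.
  rewrite !vf_bracketE !linearB /= jacobi_aux.
  by apply: val_inj; apply/funext.
- move=> d e f; apply: gauge_section_ext => [u|g].
    rewrite gauge_bracketE gauge_app_add !gauge_app_fmul gauge_bracketE.
    by rewrite gauge_appM fmulB addrAC.
  rewrite gauge_anchor_bracket gauge_anchor_add !gauge_anchor_fmul vf_app_add.
  rewrite gauge_anchor_bracket vf_bracketE !vf_app_fmul vf_bracketE.
  by rewrite vf_appM mulrBr addrAC [vf_app (j e) g * _]mulrC.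
- by move=> d e; exact: gauge_anchor_bracket.
Qed.
End GaugeLieAlgebroid.

Section ECourantAlgebroids.
Context (R : realType) (n : nat) (M : manifold R n) (E : vector_bundle M).

Record e_pairing (K : vector_bundle M) := EPairing {
  pairing :> forall m, vb_fib K m -> vb_fib K m -> vb_fib E m;
  pairing_linear : forall m (k : vb_fib K m), linear (pairing k);
  pairing_sym : forall m (k l : vb_fib K m), pairing k l = pairing l k;
  pairing_nondeg : forall m (k : vb_fib K m),
    (forall l, pairing k l = 0) -> k = 0;
  pairing_smooth : forall X Y : section K,
    @smooth_section _ _ _ E (fun m => pairing (X m) (Y m)) }.
Arguments pairing {K} _ m k l.

Definition pair_sec (K : vector_bundle M) (P : e_pairing K) (X Y : section K) :
  section E := mk_section (pairing_smooth P X Y).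

Definition rho_star (K : vector_bundle M) (rho : bundle_map K (gauge E)) (m : M)
    (nu : {linear gauge_fib E m -> vb_fib E m}) : vb_fib K m -> vb_fib E m :=
  fun k => nu (rho m k).

(* [k] is the element of K identified with rho^*(nu): (k, x)_E = nu (rho x) / 2. *)
Definition represents (K : vector_bundle M) (P : e_pairing K)
    (rho : bundle_map K (gauge E)) (m : M)
    (nu : {linear gauge_fib E m -> vb_fib E m}) (k : vb_fib K m) : Prop :=
  forall x, P m k x = 2^-1 *: rho_star rho nu x.

Record e_courant := ECourant {
  ec_bundle :> vector_bundle M;
  ec_pair : e_pairing ec_bundle;
  ec_bracket : section ec_bundle -> section ec_bundle -> section ec_bundle;
  ec_rho : bundle_map ec_bundle (gauge E);
  ec_leibniz : is_leibniz_algebra ec_bracket;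
  ec_1 : forall X Y : section ec_bundle,
    bm_sec ec_rho (ec_bracket X Y) =
    gauge_bracket (bm_sec ec_rho X) (bm_sec ec_rho Y);
  ec_2 : forall (X : section ec_bundle) (m : M),
    represents ec_pair ec_rho (jet (pair_sec ec_pair X X) m) (ec_bracket X X m);
  ec_3 : forall X Y Z : section ec_bundle,
    gauge_app (bm_sec ec_rho X) (pair_sec ec_pair Y Z) =
    pair_sec ec_pair (ec_bracket X Y) Z + pair_sec ec_pair Y (ec_bracket X Z);
  ec_4 : forall (m : M) (mu : {linear gauge_fib E m -> vb_fib E m}),
    is_jet mu -> exists k, represents ec_pair ec_rho mu k;
  ec_5 : forall (m : M) (mu : {linear gauge_fib E m -> vb_fib E m})
      (k : vb_fib ec_bundle m),
    is_jet mu -> represents ec_pair ec_rho mu k -> ec_rho m k = 0 }.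

End ECourantAlgebroids.

(* A subbundle of K: fibrewise subspaces carrying a vector bundle structure for
   which the inclusion into K is smooth. *)
Record subbundle (R : realType) (n : nat) (M : manifold R n)
    (K : vector_bundle M) := Subbundle {
  sb_fib : forall m, {vspace vb_fib K m};
  sb_atlas : bundle_atlas (fun m => subvs_of (sb_fib m) : vectType R);
  sb_smooth : forall s : section (VectorBundle sb_atlas),
    @smooth_section _ _ _ K (fun m => vsval (s m)) }.

Definition sb_bundle (R : realType) (n : nat) (M : manifold R n)
    (K : vector_bundle M) (L : subbundle K) : vector_bundle M :=
  VectorBundle (sb_atlas L).
Coercion sb_bundle : subbundle >-> vector_bundle.

Definition sb_incl (R : realType) (n : nat) (M : manifold R n)
    (K : vector_bundle M) (L : subbundle K) : bundle_map L K :=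
  @BundleMap _ _ _ L K
    (fun m => @vsval _ _ (sb_fib L m) : {linear subvs_of (sb_fib L m) -> vb_fib K m})
    (@sb_smooth _ _ _ _ L).

Section Dirac.
Context (R : realType) (n : nat) (M : manifold R n) (E : vector_bundle M).

Definition orthogonal (K : e_courant E) (L : subbundle K) (m : M) :
    set (vb_fib K m) :=
  [set k | forall l, l \in sb_fib L m -> ec_pair K m k l = 0].
Arguments orthogonal {K} L m _.

Record dirac (K : e_courant E) := Dirac {
  dirac_sub :> subbundle K;
  dirac_closed : forall X Y : section dirac_sub, exists Z : section dirac_sub,
    bm_sec (sb_incl dirac_sub) Z =
    ec_bracket (bm_sec (sb_incl dirac_sub) X) (bm_sec (sb_incl dirac_sub) Y);
  dirac_orthogonal : forall m,
    [set k | k \in sb_fib dirac_sub m] = orthogonal dirac_sub m }.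

Context (K : e_courant E) (L : dirac K).

Definition dirac_bracket (X Y : section L) : section L :=
  sval (cid (dirac_closed X Y)).

Lemma dirac_bracketE (X Y : section L) :
  bm_sec (sb_incl L) (dirac_bracket X Y) =
  ec_bracket (bm_sec (sb_incl L) X) (bm_sec (sb_incl L) Y).
Proof. exact: svalP (cid (dirac_closed X Y)). Qed.

Definition dirac_rho : bundle_map L (gauge E) := bm_comp (ec_rho K) (sb_incl L).

Definition dirac_anchor : bundle_map L (TM M) := bm_comp (gauge_anchor E) dirac_rho.

End Dirac.

(* Main.v *)
From HB Require Import structures.
Require Import Defs.
From mathcomp Require Import all_boot all_order all_algebra.
From mathcomp Require Import ring.
From mathcomp Require Import boolp classical_sets functions.
From mathcomp Require Import reals interval_inference topology normedtype derive.
From mathcomp Require Import sequences realfun exp.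
Set Implicit Arguments. Unset Strict Implicit. Unset Printing Implicit Defensive.
Import Order.TTheory GRing.Theory Num.Theory numFieldNormedType.Exports.
Local Open Scope classical_set_scope.
Local Open Scope ring_scope.

(** Sections of a Dirac structure L pair to zero with each other, so [ec_2] makes
the bracket alternating on L; an alternating Leibniz bracket is a Lie bracket.
By [ec_1] the anchor rho respects brackets, and so does its composite with
the symbol map j.  These points are formal.

The Leibniz rule [X, fY] = f [X, Y] + j(rho X)(f) Y holds in the whole of K:
expanding rho(X)(fY, Z) with [ec_3], and again as rho(X)(f (Y, Z)) with
the derivation property of rho(X), shows that both sides have the same pairing
with every section Z ([ec_bracket_fmul]).  Nondegeneracy of the pairing is
a statement about each fibre, so concluding requires a global smooth section
through every vector of K ([exists_section_through]).  Sections of L alone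
would not do, since L is isotropic.

Such a section is a local one, constant in a trivialisation, multiplied by
a bump function ([bump_exists]).  The bump is exp(-1/x) composed with
r^2 - |chart - c|^2.  Its smoothness follows from the fact that the functions
x^-N exp(-1/x), extended by 0 to x <= 0, are differentiable with derivatives
in their own linear span, together with the smoothness of the transition maps.
Its support is compact, hence closed because M is Hausdorff, so that extending
by zero preserves smoothness. *)

(** * Smoothness of exp(-1/x) *)

Section Flat.
Context (R : realType).
Implicit Types x y t : R.

(** The factor x^-N makes the span of the family stable under differentiation,
so that all members can be proved smooth together. *)
Definition flat (N : nat) x : R :=
  if 0 < x then x^-1 ^+ N * expR (- x^-1) else 0.

Lemma flat0 N x : x <= 0 -> flat N x = 0.
Proof. by rewrite /flat leNgt => /negbTE ->. Qed.

Lemma flat_gt0 N x : 0 < x -> 0 < flat N x.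
Proof. by move=> x0; rewrite /flat x0 mulr_gt0 ?expR_gt0// exprn_gt0 ?invr_gt0. Qed.

Lemma flat_ge0 N x : 0 <= flat N x.
Proof. by case: (ltP 0 x) => [/(flat_gt0 N)/ltW//|/(flat0 N) ->]. Qed.

(** With t = 1/x this is t^(N+1) / (N+1)! <= exp t, a term of the exponential
series.  The bound is what makes the difference quotients at 0 converge. *)
Lemma flat_bound N x : flat N.+1 x <= N.+1`!%:R.
Proof.
case: (ltP 0 x) => [x0|/flat0 ->]; last exact: ler0n.
rewrite /flat x0 expRN ler_pdivrMr ?expR_gt0// mulrC.
rewrite -ler_pdivrMr ?ltr0n ?fact_gt0//.
apply: le_trans (expR_ge1Dxn N (ltW _)); first by rewrite ler_wpDl.
by rewrite invr_gt0.
Qed.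

Lemma flatS N x : flat N x = x * flat N.+1 x.
Proof.
rewrite /flat; case: ifPn => x0; last by rewrite mulr0.
by rewrite exprS !mulrA mulfV ?mul1r// gt_eqF.
Qed.

(** Away from 0 this is the product rule.  At 0 the growth rate is
flat N h / h = flat N.+1 h = h * flat N.+2 h, which tends to 0 because the last
factor is bounded. *)
Lemma is_derive_flat N x :
  is_derive x 1 (flat N) (flat N.+2 x - N%:R * flat N.+1 x).
Proof.
have [x0|x0|->] := ltgtP x 0.
- rewrite !flat0 ?ltW// mulr0 subr0.
  have d0 : is_derive x 1 (cst 0 : R -> R) 0 by exact: is_derive_cst.
  apply: (near_eq_is_derive _ d0); near=> y.
  by rewrite flat0// ltW//; near: y; exact: lt_nbhsl.
- have xN0 : x != 0 by rewrite gt_eqF.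
  pose g (y : R) : R := y^-1 ^+ N * expR (- y^-1).
  have dinv := is_deriveV xN0 (is_derive_id x 1).
  have dg : is_derive x 1 g (flat N.+2 x - N%:R * flat N.+1 x).
    have dexp : is_derive x 1 (expR \o (fun y => - y^-1))
        (expR (- x^-1) * - (- x ^- 2)%:A).
      apply: is_derive1_comp (is_derive_expR _) _; exact: is_deriveN dinv.
    have := is_deriveM (is_deriveX N dinv) dexp.
    have -> : (GRing.inv : R -> R) ^+ N * (expR \o (fun y => - y^-1)) = g.
      by apply/funext => y; rewrite /g !fctE.
    move=> dg; apply: (@is_derive_eq _ _ _ _ _ _ _ _ dg).
    rewrite /flat x0 /= !fctE /GRing.scale /=.
    case: (N) => [|N'] /=; first by field.
    by rewrite !exprS; field.
  apply: (near_eq_is_derive _ dg); near=> y.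
  rewrite /flat ifT//; near: y; exact: lt_nbhsr.
- rewrite !flat0// mulr0 subr0.
  have cv : h^-1 *: (flat N (h *: 1 + 0) - flat N 0) @[h --> 0^'] --> (0 : R).
    apply/cvgr0Pnorm_le => e e0; near=> h.
    have h0 : h != 0 by near: h; exact: nbhs_dnbhs_neq.
    rewrite [h *: 1]mulr1 addr0 (flat0 N (lexx 0)) subr0 flatS scalerA mulVf// scale1r.
    rewrite flatS normrM [X in _ * X]ger0_norm ?flat_ge0//.
    have C0 : 0 < N.+2`!%:R :> R by rewrite ltr0n fact_gt0.
    apply: le_trans (ler_wpM2l _ (flat_bound _ _)) _ => //.
    rewrite -ler_pdivlMr//; near: h; apply: dnbhs0_le; exact: divr_gt0.
  by apply: DeriveDef; [apply/cvg_ex; exists 0|exact: cvg_lim].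
Unshelve. all: by end_near. Qed.

(** The induction on the order of differentiability is over all N at once, as
the chain rule replaces flat N by a combination of flat N.+2 and flat N.+1. *)
Lemma smooth_flat n (U : set 'rV[R]_n) (f : 'rV[R]_n -> R) N : open U ->
  smooth_on U f -> smooth_on U (flat N \o f).
Proof.
move=> oU sf k; elim: k N => [|k IH] N.
  move=> x Ux; apply: continuous_comp; first exact: (sf 0%N).
  apply/differentiable_continuous/derivable1_diffP.
  exact: (@ex_derive _ _ _ _ _ _ _ (is_derive_flat N (f x))).
have [df Df] := sf k.+1; have dF x := is_derive_flat N x.
have dF' x : differentiable (flat N) x.
  by apply/derivable1_diffP; exact: (@ex_derive _ _ _ _ _ _ _ (dF x)).
have dFf (x : 'rV[R]_n) : U x -> differentiable (flat N \o f) x.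
  by move=> Ux; apply: differentiable_comp; [exact: df|exact: dF'].
split=> [x Ux|v]; first exact: dFf.
have := Ck_onM oU (Ck_onD oU (IH N.+2)
  (Ck_onM oU (@Ck_on_cst _ _ U k (- N%:R)) (IH N.+1))) (Df v).
apply: eq_Ck_on => // x Ux /=.
rewrite (deriveE _ (dFf _ Ux)) (deriveE _ (df _ Ux)) (diff_comp (df _ Ux) (dF' _)) /=.
rewrite (diff1E (dF' _)) /=.
by rewrite derive1E (@derive_val _ _ _ _ _ _ _ (dF (f x))) mulNr mulrC.
Qed.

End Flat.

(** * Gluing and sums of smooth functions *)

Section Locality.
Context (R : realType) (n : nat).

Lemma Ck_onU k (U V : set 'rV[R]_n) f :
  Ck_on k U f -> Ck_on k V f -> Ck_on k (U `|` V) f.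
Proof.
elim: k f => [|k IH] f /=; first by move=> fU fV x [/fU|/fV].
move=> [dU DU] [dV DV]; split=> [x [/dU|/dV]//|v].
exact: IH.
Qed.

Lemma Ck_on_sum k (U : set 'rV[R]_n) (I : Type) (r : seq I) (F : I -> 'rV[R]_n -> R) :
  open U -> (forall i, Ck_on k U (F i)) ->
  Ck_on k U (fun y => \sum_(i <- r) F i y).
Proof.
move=> oU FU; elim: r => [|i r IH].
  have := @Ck_on_cst _ _ U k 0.
  by congr Ck_on; apply/funext => y; rewrite big_nil.
have := Ck_onD oU (FU i) IH.
by congr Ck_on; apply/funext => y /=; rewrite big_cons.
Qed.

Context (M : manifold R n).

Lemma smooth_fun_onU (U V : set M) f :
  smooth_fun_on U f -> smooth_fun_on V f -> smooth_fun_on (U `|` V) f.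
Proof.
move=> fU fV i k; rewrite preimage_setU setIUr.
exact: Ck_onU (fU i k) (fV i k).
Qed.

Lemma eq_smooth_fun_on (W : set M) f g : open W -> (forall m, W m -> f m = g m) ->
  smooth_fun_on W f -> smooth_fun_on W g.
Proof.
move=> oW fg sf i k; apply: eq_Ck_on (sf i k); first exact: open_chart_preimage.
by move=> y [_ /fg].
Qed.

End Locality.

(** * Bump functions and sections through a given vector *)

Section Bump.
Context (R : realType) (n : nat) (M : manifold R n).

(** Read in the chart j, the coordinates of the chart i are components of
a transition map. *)
Lemma smooth_chart_sqdist (i : chart_index M) (c : 'rV[R]_n) (r : R)
    (j : chart_index M) :
  smooth_on (chart_ran M j `&` chart_inv M j @^-1` chart_dom M i)
    (fun y => r ^+ 2 - \sum_k (chart M i (chart_inv M j y) 0 k - c 0 k) ^+ 2).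
Proof.
move=> p; have oU := open_chart_preimage (i := j) (@chart_dom_open _ _ M i).
set U := (_ `&` _) in oU *.
pose t k y := chart M i (chart_inv M j y) 0 k - c 0 k.
have st k : Ck_on p U (t k).
  exact: (Ck_onD oU (@chart_transition _ _ M j i k p) (@Ck_on_cst _ _ U p (- c 0 k))).
have := Ck_onD oU (@Ck_on_cst _ _ U p (r ^+ 2)) (Ck_onM oU (@Ck_on_cst _ _ U p (-1))
  (Ck_on_sum (index_enum 'I_n) oU (fun k => Ck_onM oU (st k) (st k)))).
by congr Ck_on; apply/funext => y /=; rewrite mulN1r.
Qed.

(** The closed set C contains the support.  It is a compact coordinate ball, and
it is given explicitly because multiplying by b something that is smooth only
over W yields something smooth everywhere. *)
Lemma bump_exists (W : set M) (m : M) : open W -> W m ->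
  exists (b : M -> R) (C : set M), [/\ smooth_fun_on setT b, closed C, C `<=` W,
    (forall x, ~ C x -> b x = 0) & b m != 0].
Proof.
move=> oW Wm; have [i im] := chart_cover m.
set c := chart M i m.
pose Q := chart_ran M i `&` chart_inv M i @^-1` W.
have oQ : open Q by exact: open_chart_preimage.
have Qc : Q c by split; [exact: chart_sub|rewrite /preimage /= /c chartK].
have /nbhs_closedballP[r rQ] : nbhs c Q by exact: open_nbhs_nbhs.
pose D := closed_ball c r%:num.
have cD : compact D.
  apply: bounded_closed_compact; last exact: closed_ball_closed.
  exists (`|c| + r%:num); split; first exact: num_real.
  move=> e re y; rewrite /D closed_ballE// /closed_ball_ /= => Dy.
  apply: le_trans (ltW re); rewrite -[y](subrK c) addrC.
  by rewrite (le_trans (ler_normD _ _))// lerD2l distrC.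
pose C := chart_inv M i @` D.
have cC : closed C.
  apply: compact_closed; first exact: manifold_hausdorff.
  apply: continuous_compact => //; apply: continuous_in_subspaceT => y /set_mem Dy.
  by apply: chart_inv_continuous; have [] := rQ _ Dy.
pose b x : R := if `[< chart_dom M i x >] then
  flat 0 (r%:num ^+ 2 - \sum_k (chart M i x 0 k - c 0 k) ^+ 2) else 0.
have b0 x : ~ C x -> b x = 0.
  move=> nCx; rewrite /b; case: asboolP => // ix; apply: flat0.
  (* The norm of R^n is the maximum norm, bounded by the Euclidean one, so
     the Euclidean ball where b is nonzero lies in D. *)
  rewrite subr_le0 leNgt; apply/negP => lt_r; apply: nCx.
  exists (chart M i x); last exact: chartK.
  rewrite /D closed_ballE// /closed_ball_ /=.
  rewrite [leLHS]/Num.norm /= mx_normrE; apply/bigmax_leP; split=> //= -[a k] _ /=.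
  rewrite (ord1 a) !mxE -(ler_pXn2r (n := 2))// ?nnegrE//.
  rewrite -normrX ger0_norm ?sqr_ge0// -sqrrN opprB.
  apply: le_trans (ltW lt_r); rewrite (bigD1 k)//= lerDl sumr_ge0// => *.
  exact: sqr_ge0.
exists b, C; split=> //.
- have -> : setT = chart_dom M i `|` ~` C.
    apply/esym/seteqP; split=> // x _.
    have [Cx|nCx] := pselect (C x); last by right.
    left; case: Cx => y Dy <-; apply: chart_inv_sub.
    by have [] := rQ _ Dy.
  apply: smooth_fun_onU; last first.
    apply: (eq_smooth_fun_on (f := fun=> 0)); first exact: closed_openC.
      by move=> x nCx; rewrite b0.
    exact: smooth_fun_on_cst.
  move=> j p.
  have oU := open_chart_preimage (i := j) (@chart_dom_open _ _ M i).
  apply: eq_Ck_on (smooth_flat 0 oU (smooth_chart_sqdist i c r%:num j) p) => //.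
  by move=> y [_ /= iy]; rewrite /b asboolT.
- by move=> x [y /rQ[_ Wy] <-].
- rewrite /b asboolT// gt_eqF// flat_gt0// big1 ?subr0 ?exprn_gt0// => k _.
  by rewrite subrr expr0n.
Qed.

End Bump.

(** The vector, moved to the neighbouring fibres by a trivialisation, is cut off
by a bump function b; dividing by b m restores its value at m. *)
Lemma exists_section_through (R : realType) (n : nat) (M : manifold R n)
    (V : vector_bundle M) (m : M) (v : V m) : exists Z : section V, Z m = v.
Proof.
pose A := vb_atlas V; have [a am] := triv_cover A m.
have [b [C [sb cC CW bC bm]]] := bump_exists (triv_dom_open A a) am.
pose w := triv A a m v.
pose s x : V x := b x *: (triv A a x)^-1%VF w.
have ss : vb_smooth (E := V) s.
  move=> a' j.
  have -> : triv_dom A a' = (triv_dom A a `&` triv_dom A a') `|` (triv_dom A a' `&` ~` C).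
    apply/seteqP; split=> x; last by case=> -[].
    move=> a'x; have [Cx|nCx] := pselect (C x); last by right.
    by left; split=> //; exact: CW.
  apply: smooth_fun_onU.
    have oW := openI (triv_dom_open A a) (triv_dom_open A a').
    have := smooth_fun_onM oW (sub_smooth_fun_on (@subsetT _ _) sb)
      (@triv_transition _ _ _ _ A a a' w j).
    by congr smooth_fun_on; apply/funext => x; rewrite /s linearZ mxE.
  apply: (eq_smooth_fun_on (f := fun=> 0)).
  - by apply: openI; [exact: triv_dom_open|exact: closed_openC].
  - by move=> x [_ nCx]; rewrite /s bC// scale0r linear0 mxE.
  - exact: smooth_fun_on_cst.
exists ((b m)^-1 *: @mk_section _ _ _ V s ss).
change ((b m)^-1 *: s m = v); rewrite /s scalerA mulVf// scale1r.
by rewrite /w lker0_lfunK//; apply/eqP; exact: (triv_inj am).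
Qed.

(** * The pairing and the bracket on sections of K *)

Section Pairing.
Context (R : realType) (n : nat) (M : manifold R n) (E K : vector_bundle M).
Variable P : e_pairing E K.

HB.instance Definition _ m (k : vb_fib K m) :=
  GRing.isLinear.Build R (vb_fib K m) (vb_fib E m) _ (P m k) (pairing_linear P k).

Lemma pair_sec_sym (X Y : section K) : pair_sec P X Y = pair_sec P Y X.
Proof. by apply: section_ext => m; exact: pairing_sym. Qed.

Lemma pair_sec_fmul (f : Cinf M) (X Y : section K) :
  pair_sec P X (fmul f Y) = fmul f (pair_sec P X Y).
Proof. by apply: section_ext => m; exact: linearZ. Qed.

Lemma pair_sec_fmull (f : Cinf M) (X Y : section K) :
  pair_sec P (fmul f X) Y = fmul f (pair_sec P X Y).
Proof. by rewrite pair_sec_sym pair_sec_fmul pair_sec_sym. Qed.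

Lemma pair_secDl (X Y Z : section K) :
  pair_sec P (X + Y) Z = pair_sec P X Z + pair_sec P Y Z.
Proof. by rewrite !(pair_sec_sym _ Z); apply: section_ext => m; exact: linearD. Qed.

Lemma pair_secBl (X Y Z : section K) :
  pair_sec P (X - Y) Z = pair_sec P X Z - pair_sec P Y Z.
Proof. by rewrite !(pair_sec_sym _ Z); apply: section_ext => m; exact: linearB. Qed.

(** Fibrewise nondegeneracy passes to global sections because global sections
fill every fibre. *)
Lemma pair_sec_nondeg (X Y : section K) :
  (forall Z, pair_sec P X Z = pair_sec P Y Z) -> X = Y.
Proof.
move=> XY; apply/subr0_eq/section_ext => m.
apply: (pairing_nondeg (e := P)) => l; have [Z <-] := exists_section_through l.
transitivity (pair_sec P (X - Y) Z m); first by [].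
by rewrite pair_secBl XY subrr.
Qed.

End Pairing.

Section Courant.
Context (R : realType) (n : nat) (M : manifold R n) (E : vector_bundle M).
Variable K : e_courant E.
Local Notation br := (@ec_bracket _ _ _ _ K).
Local Notation P := (ec_pair K).
Local Notation rho := (bm_sec (ec_rho K)).

(** Both sides have the same pairing with every Z: compute rho(X)(fY, Z) once by
[ec_3] and once by the derivation property of rho(X). *)
Lemma ec_bracket_fmul (X Y : section K) (f : Cinf M) :
  br X (fmul f Y) =
  fmul f (br X Y) + fmul (vf_app (bm_sec (gauge_anchor E) (rho X)) f) Y.
Proof.
apply/(pair_sec_nondeg (P := P)) => Z.
have /eqP := ec_3 X (fmul f Y) Z.
rewrite pair_sec_fmull gauge_appM ec_3 pair_sec_fmull.
rewrite pair_secDl !pair_sec_fmull.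
have -> (u v : section E) : fmul f (u + v) = fmul f u + fmul f v.
  by apply: section_ext => m; exact: scalerDr.
by rewrite addrAC eq_sym => /eqP /addIr.
Qed.

(** By [ec_2], the bracket of X with itself represents the jet of (X, X), which is
zero; nondegeneracy makes its representative unique. *)
Lemma ec_bracket_isotropic (X : section K) :
  pair_sec P X X = 0 -> br X X = 0.
Proof.
move=> X0; apply: section_ext => m; apply: (pairing_nondeg (e := P)) => l.
rewrite ec_2 X0 /rho_star /= /jet_fun.
have := gauge_op_linear (ec_rho K m l) (-1) 0 0.
by rewrite scaler0 addr0 => ->; rewrite scaleN1r addNr scaler0.
Qed.

End Courant.

(** * Dirac structures *)

Section DiracTheory.
Context (R : realType) (n : nat) (M : manifold R n) (E : vector_bundle M).
Variables (K : e_courant E) (L : dirac K).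
Local Notation inclL := (bm_sec (sb_incl L)).
Local Notation br := (dirac_bracket (L := L)).

Lemma sb_incl_inj : injective inclL.
Proof.
move=> X Y XY; apply: section_ext => m; apply: val_inj.
exact: (congr1 (fun s : section K => s m) XY).
Qed.

Lemma sb_inclP a X Y : inclL (a *: X + Y) = a *: inclL X + inclL Y.
Proof. by apply: section_ext. Qed.

Lemma sb_inclD X Y : inclL (X + Y) = inclL X + inclL Y.
Proof. by apply: section_ext. Qed.

Lemma sb_incl_fmul f X : inclL (fmul f X) = fmul f (inclL X).
Proof. by apply: section_ext. Qed.

Lemma dirac_isotropic X Y : pair_sec (ec_pair K) (inclL X) (inclL Y) = 0.
Proof.
apply: section_ext => m.
have LX k : k \in sb_fib L m -> Defs.orthogonal L (m := m) k.
  by rewrite -dirac_orthogonal.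
apply: (LX (vsval (X m))); exact: subvsP.
Qed.

Lemma dirac_bracketxx X : br X X = 0.
Proof.
apply: sb_incl_inj; rewrite dirac_bracketE.
by rewrite ec_bracket_isotropic ?dirac_isotropic//; apply: section_ext.
Qed.

Lemma dirac_leibniz : is_leibniz_algebra br.
Proof.
have [lr ll J] := ec_leibniz K.
split=> [X a Y Z|Y a X Z|X Y Z]; apply: sb_incl_inj.
- by rewrite sb_inclP !dirac_bracketE sb_inclP lr.
- by rewrite sb_inclP !dirac_bracketE sb_inclP ll.
- by rewrite sb_inclD !dirac_bracketE J.
Qed.

End DiracTheory.

(** Skewness turns the Leibniz identity, which says that each bracket with x is
a derivation, into the cyclic Jacobi identity. *)
Lemma alternating_leibniz_is_lie (R : realType) (V : lmodType R)
    (br : V -> V -> V) : (forall x, br x x = 0) ->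
  is_leibniz_algebra br -> is_lie_algebra br.
Proof.
move=> alt [lr ll J]; split=> // x y z.
have brDr u v w : br u (v + w) = br u v + br u w.
  by rewrite -[v]scale1r lr !scale1r.
have brDl u v w : br (v + w) u = br v u + br w u.
  by rewrite -[v]scale1r ll !scale1r.
have br0 u : br u 0 = 0.
  by apply: (addrI (br u 0)); rewrite -brDr !addr0.
have brNr u v : br u (- v) = - br u v.
  by have := lr u (-1) v 0; rewrite addr0 !scaleN1r br0 addr0.
have skew u v : br u v = - br v u.
  apply/eqP; rewrite -addr_eq0; apply/eqP.
  by have := alt (u + v); rewrite brDr !brDl !alt addr0 add0r addrC.
by rewrite J (skew z x) (skew z (br x y)) brNr addrK subrr.
Qed.

Theorem proposition2p6 (R : realType) (n : nat) (M : manifold R n)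
    (E : vector_bundle M) (K : e_courant E) (L : dirac K) :
  is_lie_algebroid (dirac_bracket (L := L)) (dirac_anchor L) /\
  is_representation (dirac_bracket (L := L)) (dirac_anchor L) (dirac_rho L).
Proof.
have rhoE X : bm_sec (dirac_rho L) X = bm_sec (ec_rho K) (bm_sec (sb_incl L) X).
  by apply: section_ext.
have anchorE X : bm_sec (dirac_anchor L) X =
    bm_sec (gauge_anchor E) (bm_sec (dirac_rho L) X) by apply: section_ext.
have rho_br X Y : bm_sec (dirac_rho L) (dirac_bracket X Y) =
    gauge_bracket (bm_sec (dirac_rho L) X) (bm_sec (dirac_rho L) Y).
  by rewrite !rhoE dirac_bracketE ec_1.
split; last by split.
split.
- exact: alternating_leibniz_is_lie (@dirac_bracketxx _ _ _ _ _ L) (dirac_leibniz L).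
- move=> X Y f; apply: sb_incl_inj; rewrite dirac_bracketE.
  rewrite sb_inclD !sb_incl_fmul ec_bracket_fmul dirac_bracketE.
  by rewrite anchorE rhoE.
- by move=> X Y; rewrite !anchorE rho_br gauge_anchor_bracket.
Qed.
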